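(* Let $R=[a,b]\times[c,d]$, let $\Delta$ be a net on $R$ and let $\alpha\in\mathcal{C}(R)$ with $\|\alpha\|_\infty<1$. The multi-valued mapping $\mathcal{W}^\alpha_\Delta:\mathcal{C}(R)\rightrightarrows\mathcal{C}(R)$ defined by $$\mathcal{W}^\alpha_\Delta(f)=\{f^\alpha_{\Delta,B_{m,n}}:m,n\in\mathbb{N}\}$$ is a Lipschitz process (i.e. it is both Lipschitz and a process).
   Context: Here $a<b$, $c<d$, and $\mathcal{C}(R)$ is the Banach space of continuous real functions on $R$ with supremum norm $\|\cdot\|_\infty$. Bernstein operator: for $m,n\in\mathbb{N}$ and $f\in\mathcal{C}(R)$, $$B_{m,n}(f)(x,y)=\frac{1}{(b-a)^m(d-c)^n}\sum_{i=0}^m\sum_{j=0}^n f\Big(a+\tfrac{i(b-a)}{m},c+\tfrac{j(d-c)}{n}\Big)\binom{m}{i}\binom{n}{j}(x-a)^i(b-x)^{m-i}(y-c)^j(d-y)^{n-j}.$$ Net: $\Delta=\{(x_i,y_j):0\le i\le N,\ 0\le j\le M\}$ with $a=x_0<x_1<\dots<x_N=b$ and $c=y_0<y_1<\dots<y_M=d$, $N,M\ge2$. Put $I=[a,b]$, $J=[c,d]$, $I_i=[x_{i-1},x_i]$, $J_j=[y_{j-1},y_j]$, $R_{ij}=I_i\times J_j$. For $1\le i\le N$, $u_i:I\to I_i$ is a contraction that is a homeomorphism onto $I_i$, with $u_i(x_0)=x_{i-1}$, $u_i(x_N)=x_i$ if $i$ is odd and $u_i(x_0)=x_i$, $u_i(x_N)=x_{i-1}$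 if $i$ is even. For $1\le j\le M$, $v_j:J\to J_j$ is a contraction that is a homeomorphism onto $J_j$, with $v_j(y_0)=y_{j-1}$, $v_j(y_M)=y_j$ if $j$ is odd and $v_j(y_0)=y_j$, $v_j(y_M)=y_{j-1}$ if $j$ is even. The maps $u_i,v_j$ are fixed for the net. Put $Q_{ij}(x,y)=(u_i^{-1}(x),v_j^{-1}(y))$ for $(x,y)\in R_{ij}$. $\alpha$-fractal function: for $f\in\mathcal{C}(R)$ and $\alpha\in\mathcal{C}(R)$ with $\|\alpha\|_\infty<1$, $f^\alpha_{\Delta,B_{m,n}}$ is the unique function in $\mathcal{C}(R)$ satisfying, for all $\boldsymbol{x}\in R_{ij}$, $1\le i\le N$, $1\le j\le M$, $$f^\alpha_{\Delta,B_{m,n}}(\boldsymbol{x})=f(\boldsymbol{x})+\alpha(\boldsymbol{x})f^\alpha_{\Delta,B_{m,n}}(Q_{ij}(\boldsymbol{x}))-\alpha(\boldsymbol{x})B_{m,n}(f)(Q_{ij}(\boldsymbol{x})).$$ It is known that this function exists and is unique and that $f\mapsto f^\alpha_{\Delta,B_{m,n}}$ is bounded and linear. A multi-valued mapping $T:X\rightrightarrows Y$ between normed spaces, with $\mathrm{Dom}(T)=\{x\in X:T(x)\ne\emptyset\}$, is a process if $\lambda T(x)=T(\lambda x)$ for all $x\in X$, $\lambda>0$, and $0\in T(0)$. It is Lipschitz if there is a constant $l>0$ with $T(x_1)\subseteq T(x_2)+l\|x_1-x_2\|_X\,U_Y$ for all $x_1,x_2\in\mathrm{Dom}(T)$, where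 $U_Y=\{y\in Y:\|y\|_Y\le1\}$. *)

(* Defs.v *)
From HB Require Import structures.
From mathcomp Require Import all_boot all_order all_algebra.
From mathcomp Require Import all_classical all_reals all_analysis.
From mathcomp Require Import ring.

Set Implicit Arguments.
Unset Strict Implicit.
Unset Printing Implicit Defensive.
Import Order.TTheory GRing.Theory Num.Theory.
Import numFieldNormedType.Exports.

Local Open Scope classical_set_scope.
Local Open Scope ring_scope.

Section MultiValued.
Context {R : realType} {X Y : normedModType R}.

Definition multi_dom (T : X -> set Y) : set X := [set x | T x !=set0].

Definition is_process (T : X -> set Y) : Prop :=
  (forall (x : X) (l : R), 0 < l -> [set l *: y | y in T x] = T (l *: x)) /\
  T 0 0.

Definition is_lipschitz_multi (T : X -> set Y) : Prop :=
  exists2 l : R, 0 < l &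
    forall x1 x2, multi_dom T x1 -> multi_dom T x2 ->
      T x1 `<=` [set y + (l * `|x1 - x2|) *: w |
                  y in T x2 & w in [set w : Y | `|w| <= 1]].

End MultiValued.

Definition rect {R : realType} (a b c d : R) : set (R * R) :=
  `[a, b] `*` `[c, d].

Section ContinuousOnRect.
Context {R : realType} {a b c d : R}.
Local Notation D := (rect a b c d).

Definition cont_rect : {pred (D -> R)} := mem [set f : D -> R | continuous f].

Lemma cont_rect_submod : submod_closed cont_rect.
Proof.
split; first by rewrite inE; exact: cst_continuous.
move=> k f g; rewrite !inE => cf cg x.
exact: (cvgD (cvgMl_tmp (a := k) (cf x)) (cg x)).
Qed.

HB.instance Definition _ := GRing.isSubmodClosed.Build R (D -> R) cont_rect
  cont_rect_submod.

End ContinuousOnRect.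

Record contfun (R : realType) (a b c d : R) := ContFun {
  contfun_val :> rect a b c d -> R;
  contfunP : contfun_val \in cont_rect }.

Section ContfunNormed.
Context {R : realType} {a b c d : R}.
Local Notation D := (rect a b c d).
Local Notation C := (contfun a b c d).

HB.instance Definition _ := [isSub for @contfun_val R a b c d].
HB.instance Definition _ := [Choice of C by <:].
HB.instance Definition _ := [SubChoice_isSubLmodule of C by <:].

Lemma contfun_cont (f : C) : continuous f.
Proof. by have := contfunP f; rewrite inE. Qed.

Definition sup_norm (f : C) : R := sup (range (fun p => `|f p|)).

Lemma rect_compact : compact D.
Proof. by apply: compact_setX; exact: segment_compact. Qed.

Lemma contfun_bounded (f : C) : has_ubound (range (fun p => `|f p|)).
Proof.
have cf : {within D, continuous (valL_ (0 : R) f)}.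
  by apply/subspace_valL_continuousP'; exact: contfun_cont.
have [M [_ /(_ (M + 1))]] := compact_bounded (continuous_compact cf rect_compact).
rewrite ltrDl ltr01 => /(_ isT) fM; exists (M + 1) => _ [p _ <-].
apply: fM; exists (\val p); first exact: set_valP.
by have /(congr1 (fun h => h p)) := @valLK _ _ (0 : R) D f.
Qed.

Lemma sup_norm_ge (f : C) (p : D) : `|f p| <= sup_norm f.
Proof. by apply: ub_le_sup; [exact: contfun_bounded|exists p]. Qed.

Lemma sup_norm_ge0 (f : C) : 0 <= sup_norm f.
Proof.
rewrite /sup_norm.
have [->|/set0P[_ [p _ _]]] := eqVneq (range (fun p => `|f p|)) set0.
  by rewrite sup0.
by apply: le_trans (sup_norm_ge f p).
Qed.

Lemma sup_norm_le (f : C) (M : R) :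
  0 <= M -> (forall p, `|f p| <= M) -> sup_norm f <= M.
Proof.
move=> M0 fM; rewrite /sup_norm.
have [->|/set0P A0] := eqVneq (range (fun p => `|f p|)) set0.
  by rewrite sup0.
by apply: ge_sup => // _ [p _ <-].
Qed.

Lemma contfunDE (f g : C) p : (f + g) p = f p + g p. Proof. by []. Qed.
Lemma contfunZE (l : R) (f : C) p : (l *: f) p = l * f p. Proof. by []. Qed.
Lemma contfunNE (f : C) p : (- f) p = - f p. Proof. by []. Qed.

Lemma sup_normD (f g : C) : sup_norm (f + g) <= sup_norm f + sup_norm g.
Proof.
apply: sup_norm_le => [|p]; first by rewrite addr_ge0 ?sup_norm_ge0.
by rewrite contfunDE (le_trans (ler_normD _ _))// lerD ?sup_norm_ge.
Qed.

Lemma sup_normZ_le (l : R) (f : C) : sup_norm (l *: f) <= `|l| * sup_norm f.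
Proof.
apply: sup_norm_le => [|p]; first by rewrite mulr_ge0 ?sup_norm_ge0.
by rewrite contfunZE normrM ler_wpM2l ?sup_norm_ge.
Qed.

Lemma sup_normZ (l : R) (f : C) : sup_norm (l *: f) = `|l| * sup_norm f.
Proof.
apply/eqP; rewrite eq_le sup_normZ_le /=.
have [->|l0] := eqVneq l 0; first by rewrite normr0 mul0r sup_norm_ge0.
rewrite -ler_pdivlMl ?normr_gt0// -normfV.
by rewrite (le_trans _ (sup_normZ_le _ _))// scalerA mulVf// scale1r.
Qed.

Lemma sup_norm0_eq0 (f : C) : sup_norm f = 0 -> f = 0.
Proof.
move=> f0; apply/val_inj/funext => p /=.
by apply/normr0_eq0/eqP; rewrite eq_le normr_ge0 andbT -f0 sup_norm_ge.
Qed.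

HB.instance Definition _ :=
  Lmodule_isNormed.Build R C sup_normD sup_normZ sup_norm0_eq0.

Lemma contfun_normE (f : C) : `|f| = sup (range (fun p => `|f p|)).
Proof. by []. Qed.

Lemma contfun_complete (F : set_system C) :
  ProperFilter F -> cauchy F -> cvg F.
Proof.
move=> FF /(cauchyP F) cF.
have normB (f g : C) p : `|f p - g p| <= `|f - g| := sup_norm_ge (f - g) p.
have cp p : cvg ((fun f : C => f p) @ F).
  apply/cauchy_cvgP/cauchy_exP => e e0.
  have [f0 Ff0] := cF e e0; exists (f0 p) => /=; rewrite nbhs_simpl.
  apply: filterS Ff0 => f /=; rewrite -!ball_normE /=.
  exact: le_lt_trans (normB _ _ _).
pose L (p : D) : R := lim ((fun f : C => f p) @ F).
have LE f0 (e : R) : F (ball f0 e) -> forall p, `|L p - f0 p| <= e.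
  move=> Ff0 p; apply/ler_addgt0Pr => h h0.
  have /cvgrPdist_lt/(_ h h0) Lh := cp p.
  have [f [Lf]] := filter_ex (filterI Lh Ff0).
  rewrite -ball_normE /= => f0f.
  apply: le_trans (ler_distD (f p) _ _) _; rewrite [leRHS]addrC lerD ?ltW//.
  by rewrite distrC; apply: le_lt_trans (normB _ _ _) f0f.
have cL : L \in cont_rect.
  rewrite inE => x; have Fx : Filter (nbhs x) := nbhs_filter x.
  apply/cvgrPdist_lt => e e0.
  have e30 : 0 < e / 3 by rewrite divr_gt0.
  have [f0 /LE L0] := cF _ e30.
  have f0x : (f0 : D -> R) y @[y --> x] --> f0 x by exact: contfun_cont.
  move/cvgrPdist_lt/(_ _ e30): f0x; apply: filterS => y f0xy.
  have -> : L x - L y = (L x - f0 x) + (f0 x - f0 y) - (L y - f0 y) by ring.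
  apply: le_lt_trans (ler_normB _ _) _.
  have -> : e = e / 3 + e / 3 + e / 3 by field.
  by rewrite ltr_leD// (le_lt_trans (ler_normD _ _))// ler_ltD.
apply/cvg_ex; exists (ContFun cL); apply/cvgrPdist_le => e e0.
have e20 : 0 < e / 2 by rewrite divr_gt0.
have [f0 Ff0] := cF _ e20; apply: filterS (Ff0) => f.
rewrite -ball_normE /= => f0f.
apply: le_trans (ler_distD f0 _ _) _; rewrite [leRHS](splitr e) lerD//; last exact: ltW.
by apply: (@sup_norm_le (ContFun cL - f0)) => [|p]; [exact: ltW|exact: LE Ff0 p].
Qed.

HB.instance Definition _ := Uniform_isComplete.Build C contfun_complete.

(* Evaluation at a point of the plane: the value of f on the rectangle, and the
   junk value 0 outside. *)
Definition ceval (f : C) : R * R -> R := valL_ 0 f.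

Lemma cevalE (f : C) (p : D) : ceval f (\val p) = f p.
Proof. by have /(congr1 (fun h => h p)) := @valLK _ _ (0 : R) D f. Qed.

End ContfunNormed.

Section Bernstein.
Context {R : realType} {a b c d : R}.

Definition bernstein (m n : nat) (f : contfun a b c d) (p : R * R) : R :=
  ((b - a) ^+ m * (d - c) ^+ n)^-1 *
  \sum_(i < m.+1) \sum_(j < n.+1)
    ceval f (a + i%:R * (b - a) / m%:R, c + j%:R * (d - c) / n%:R)
    * 'C(m, i)%:R * 'C(n, j)%:R
    * (p.1 - a) ^+ i * (b - p.1) ^+ (m - i)
    * (p.2 - c) ^+ j * (d - p.2) ^+ (n - j).

End Bernstein.

(* f restricts to a homeomorphism of A onto B; pinv A f is the inverse. *)
Definition homeo_onto {R : realType} (A B : set R) (f : R -> R) : Prop :=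
  [/\ set_bij A B f, {within A, continuous f}
    & {within B, continuous (pinv A f)}].

Definition contraction_on {R : realType} (A : set R) (f : R -> R) : Prop :=
  exists2 k : R, 0 <= k < 1 & k.-lipschitz_A f.

(* Subdivision of [a, b] together with its maps u_i; only the knots with index
   <= N and the maps with index in 1..N are meaningful. *)
Record axis (R : realType) (a b : R) := Axis {
  axis_size : nat;
  knot : nat -> R;
  axis_map : nat -> R -> R;
  axis_size_ge2 : (2 <= axis_size)%N;
  knot_first : knot 0%N = a;
  knot_last : knot axis_size = b;
  knot_lt : forall i, (i < axis_size)%N -> knot i < knot i.+1;
  axis_map_contraction : forall i, (1 <= i <= axis_size)%N ->
    contraction_on `[a, b] (axis_map i);
  axis_map_homeo : forall i, (1 <= i <= axis_size)%N ->
    homeo_onto `[a, b] `[knot i.-1, knot i] (axis_map i);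
  axis_map_odd : forall i, (1 <= i <= axis_size)%N -> odd i ->
    axis_map i a = knot i.-1 /\ axis_map i b = knot i;
  axis_map_even : forall i, (1 <= i <= axis_size)%N -> ~~ odd i ->
    axis_map i a = knot i /\ axis_map i b = knot i.-1 }.

Definition cell {R : realType} {a b : R} (s : axis a b) (i : nat) : set R :=
  `[knot s i.-1, knot s i].

Record net (R : realType) (a b c d : R) := Net {
  net_x : axis a b;
  net_y : axis c d }.

Section Fractal.
Context {R : realType} {a b c d : R}.
Local Notation C := (contfun a b c d).
Variable Delta : net a b c d.

Definition net_inv (i j : nat) (p : R * R) : R * R :=
  (pinv `[a, b] (axis_map (net_x Delta) i) p.1,
   pinv `[c, d] (axis_map (net_y Delta) j) p.2).

Definition fractal_eq (alpha : C) (m n : nat) (f g : C) : Prop :=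
  forall i j p,
    (1 <= i <= axis_size (net_x Delta))%N ->
    (1 <= j <= axis_size (net_y Delta))%N ->
    (cell (net_x Delta) i `*` cell (net_y Delta) j) p ->
    ceval g p = ceval f p + ceval alpha p * ceval g (net_inv i j p)
                - ceval alpha p * bernstein m n f (net_inv i j p).

Definition is_fractal_function (alpha : C) (m n : nat) (f g : C) : Prop :=
  unique (fractal_eq alpha m n f) g.

(* The indices m, n are positive: B_{m,n} divides by them. *)
Definition fractal_multi (alpha : C) (f : C) : set C :=
  [set g | exists m n : nat,
    [/\ (0 < m)%N, (0 < n)%N & is_fractal_function alpha m n f g]].

End Fractal.

(* Main.v *)
(* The inverses of the maps u_i agree at the common knots, because the u_i
   alternate orientation, so they glue to a continuous self-map of [a, b], and
   the Q_ij glue to a continuous self-map Q of the rectangle. The Read-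
   Bajraktarevic operator g |-> f + alpha (g - B_{m,n} f) o Q is then an
   |alpha|-contraction of C(R), so the fractal function exists for all f, m,
   n. The functional equation is linear in (f, g), and since |B_{m,n} f| <=
   |f| it yields (1 - |alpha|) |g| <= (1 + |alpha|) |f|; this gives uniqueness
   and, uniformly in (m, n), the Lipschitz constant (1 + |alpha|) / (1 -
   |alpha|). *)
Require Import Defs.
From HB Require Import structures.
From mathcomp Require Import all_boot all_order all_algebra.
From mathcomp Require Import all_classical all_reals all_analysis.
From mathcomp Require Import ring lra zify.
Import Order.TTheory GRing.Theory Num.Theory.
Import numFieldNormedType.Exports.
Local Open Scope classical_set_scope.
Local Open Scope ring_scope.

Set Implicit Arguments.
Unset Strict Implicit.

(** * Subdivisions of a segment and the gluing of the inverse maps *)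

Section Axis.
Context {R : realType} {a b : R} (s : axis a b).
Local Notation N := (axis_size s).
Local Notation inv i := (pinv `[a, b] (axis_map s i)).

Lemma knot_le i j : (i <= j <= N)%N -> knot s i <= knot s j.
Proof.
move=> /andP[]; elim: j => [|j IH]; first by rewrite leqn0 => /eqP ->.
rewrite leq_eqVlt => /orP[/eqP -> //|]; rewrite ltnS => ij jN.
exact: le_trans (IH ij (ltnW jN)) (ltW (knot_lt jN)).
Qed.

Lemma itv_knotS k : (k < N)%N ->
  [set` `[a, knot s k.+1]] = [set` `[a, knot s k]] `|` cell s k.+1.
Proof.
move=> kN; have ak : a <= knot s k.
  by rewrite -[leLHS](knot_first s) knot_le //= ltnW.
have kk := ltW (knot_lt kN).
apply/seteqP; split => x; rewrite /cell /= !in_itv /=.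
  move=> /andP[ax xk].
  by case: (lerP x (knot s k)) => h; [left|right; rewrite ltW]; rewrite ?ax.
by case=> /andP[h1 h2]; apply/andP; split => //;
  [exact: le_trans kk|exact: le_trans h1].
Qed.

Lemma cell_cover x : x \in `[a, b] ->
  exists2 i, (1 <= i <= N)%N & cell s i x.
Proof.
(* Induction on [k], peeling off the last cell of [[a, knot s k]]. *)
have H k : (1 <= k <= N)%N -> [set` `[a, knot s k]] x ->
    exists2 i, (1 <= i <= N)%N & cell s i x.
  elim: k => // k IH kN; case: k => [|k] in IH kN *.
    by move=> xk; exists 1%N => //; rewrite /cell /= knot_first.
  rewrite itv_knotS // => -[xk|xk]; last by exists k.+2.
  by apply: IH => //; exact: ltnW.
rewrite -[X in _ \in `[a, X]](knot_last s); apply: H.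
by rewrite leqnn andbT (ltnW (axis_size_ge2 _)).
Qed.

Lemma cell_itv i x : (1 <= i <= N)%N -> cell s i x -> x \in `[a, b].
Proof.
move=> /andP[i1 iN]; rewrite /cell /= !in_itv /= => /andP[ix xi].
have := @knot_le 0 i.-1; have := @knot_le i N.
rewrite knot_first knot_last iN leqnn /= (leq_trans (leq_pred _) iN).
by move=> /(_ isT) /(le_trans xi) -> /(_ isT) /le_trans ->.
Qed.

Lemma inv_itv i x : (1 <= i <= N)%N -> cell s i x -> [set` `[a, b]] (inv i x).
Proof.
move=> iN xi; have [bij _ _] := axis_map_homeo iN.
by have [f _ _] := bijpinv_bij (fun=> point) bij; exact: f.
Qed.

(* u_k and u_{k+1} send the same endpoint of [a, b] to x_k: b if k is odd, a if
   k is even. *)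
Lemma inv_knot k : a < b -> (1 <= k < N)%N ->
  inv k (knot s k) = inv k.+1 (knot s k).
Proof.
move=> ab /andP[k1 kN].
have kN1 : (1 <= k <= N)%N by rewrite k1 ltnW.
have kN2 : (1 <= k.+1 <= N)%N by [].
have invK i z : (1 <= i <= N)%N -> z \in `[a, b] ->
    inv i (axis_map s i z) = z.
  move=> iN zab; have [[_ inj _] _ _] := axis_map_homeo iN.
  by apply: pinvKV => //; rewrite inE.
have aab : a \in `[a, b] by rewrite in_itv /= lexx ltW.
have bab : b \in `[a, b] by rewrite in_itv /= lexx ltW.
case: (boolP (odd k)) => ok.
  have [_ e1] := axis_map_odd kN1 ok.
  have [|_ e2] := axis_map_even kN2; first by rewrite /= negbK.
  by rewrite -{1}e1 invK // -[in RHS]e2 invK.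
have [e1 _] := axis_map_even kN1 ok.
have [|e2 _] := axis_map_odd kN2; first by rewrite /= ok.
by rewrite -{1}e1 invK // -[in RHS]e2 invK.
Qed.

(** The inverses are pasted one cell at a time from the left: the map built so far and the next
    inverse live on closed intervals that meet in a single knot, where [inv_knot] makes them
    agree. *)
Lemma glued_inverse : a < b -> exists U : R -> R,
  (forall i x, (1 <= i <= N)%N -> cell s i x -> U x = inv i x) /\
  {within `[a, b], continuous U}.
Proof.
move=> ab.
suff H k : (1 <= k <= N)%N -> exists U : R -> R,
    (forall i x, (1 <= i <= k)%N -> cell s i x -> U x = inv i x) /\
    {within `[a, knot s k], continuous U}.
  have [|U] := H N; first by rewrite leqnn (ltnW (axis_size_ge2 _)).
  by rewrite knot_last; exists U.
elim: k => // k IH kN; case: k => [|k] in IH kN *.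
  exists (inv 1); split.
    by move=> i x /andP[i1 i2] _; have -> : i = 1%N by lia.
  by have [_ _] := axis_map_homeo kN; rewrite /= knot_first.
have [|U [Ui Uc]] := IH; first by rewrite /= ltnW.
set y := knot s k.+1 in Uc *.
pose V x := if x <= y then U x else inv k.+2 x.
have Vi i x : (1 <= i <= k.+2)%N -> cell s i x -> V x = inv i x.
  move=> /andP[i1 i2] xi; move: (xi); rewrite /cell /= in_itv /= => /andP[x1 x2].
  rewrite /V; move: i2; rewrite leq_eqVlt => /orP[/eqP ik|ik].
    (* In the newly added cell, [V] follows [U] only at its left end [y]; there [U] is the previous
       inverse. *)
    subst i; case: ifPn => // xy.
    have -> : x = y by apply/eqP; rewrite eq_le xy.
    rewrite (Ui k.+1); first exact: inv_knot.
      by rewrite leqnn.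
    rewrite /cell /= in_itv /= lexx andbT; apply: knot_le.
    by rewrite leqnSn ltnW.
  have -> : x <= y.
    by apply: le_trans x2 _; apply: knot_le; rewrite -ltnS ik ltnW.
  by apply: Ui => //; rewrite i1.
exists V; split => //; rewrite itv_knotS //.
(* Pasting lemma for two closed sets; on each of them [V] equals a function already known to be
   continuous. *)
apply: withinU_continuous; rewrite /cell;
  [exact: itv_closed|exact: itv_closed| |].
  apply: subspace_eq_continuous Uc => x; rewrite inE /= in_itv /= => /andP[_ xy].
  by rewrite /from_subspace /V /= xy.
have [_ _] := axis_map_homeo kN; apply: subspace_eq_continuous => x.
rewrite inE => xk; apply/esym; apply: Vi => //.
by rewrite leqnn.
Qed.

End Axis.

(** * Evaluation of continuous functions at points of the plane *)

Section Evaluation.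
Context {R : realType} {a b c d : R}.
Local Notation D := (rect a b c d).
Local Notation C := (contfun a b c d).

Lemma cevalP (f : C) q (Dq : q \in D) : ceval f q = f (SigSub Dq).
Proof. exact: (cevalE f (SigSub Dq)). Qed.

Lemma ceval_out (f : C) q : q \notin D -> ceval f q = 0.
Proof. by move=> Dq; rewrite /ceval /valL_ /= oinv_set_val insubN. Qed.

(** The junk value 0 keeps evaluation linear off the rectangle too. *)
Lemma cevalB (f g : C) q : ceval (f - g) q = ceval f q - ceval g q.
Proof.
case: (boolP (q \in D)) => Dq; first by rewrite !cevalP.
by rewrite !ceval_out // subrr.
Qed.

Lemma cevalZ (l : R) (f : C) q : ceval (l *: f) q = l * ceval f q.
Proof.
case: (boolP (q \in D)) => Dq; first by rewrite !cevalP.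
by rewrite !ceval_out // mulr0.
Qed.

Lemma ceval0 q : ceval (0 : C) q = 0.
Proof. by rewrite -(scale0r (0 : C)) cevalZ mul0r. Qed.

Lemma ceval_le (f : C) q : `|ceval f q| <= `|f|.
Proof.
case: (boolP (q \in D)) => Dq; first by rewrite cevalP; exact: sup_norm_ge.
by rewrite ceval_out // normr0.
Qed.

Lemma contfun_norm_le (f : C) (M : R) :
  0 <= M -> (forall q, D q -> `|ceval f q| <= M) -> `|f| <= M.
Proof.
move=> M0 fM; apply: sup_norm_le => // p.
by rewrite -cevalE; apply: fM; exact: set_valP.
Qed.

End Evaluation.

(** * Linearity, norm bound and continuity of the Bernstein operator *)

Section BernsteinBounds.
Context {R : realType} {a b c d : R}.
Local Notation D := (rect a b c d).
Local Notation C := (contfun a b c d).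

Lemma bernsteinB m n (f g : C) p :
  bernstein m n (f - g) p = bernstein m n f p - bernstein m n g p.
Proof.
rewrite /bernstein -mulrBr -sumrB; congr (_ * _); apply: eq_bigr => i _.
by rewrite -sumrB; apply: eq_bigr => j _; rewrite cevalB; ring.
Qed.

Lemma bernsteinZ m n (l : R) (f : C) p :
  bernstein m n (l *: f) p = l * bernstein m n f p.
Proof.
rewrite /bernstein mulrCA; congr (_ * _); rewrite mulr_sumr.
apply: eq_bigr => i _; rewrite mulr_sumr; apply: eq_bigr => j _.
by rewrite cevalZ; ring.
Qed.

Lemma bernstein0 m n p : bernstein m n (0 : C) p = 0.
Proof. by rewrite -(scale0r (0 : C)) bernsteinZ mul0r. Qed.

(** Binomial theorem for [z - y = (z - x) + (x - y)]; it gives the total mass of the Bernstein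
    weights in one variable. *)
Lemma binomial_weights m (x y z : R) :
  \sum_(i < m.+1) 'C(m, i)%:R * (x - y) ^+ i * (z - x) ^+ (m - i) =
  (z - y) ^+ m.
Proof.
rewrite -[z - y](subrKA x) exprDn; apply: eq_bigr => i _.
by rewrite -mulr_natl; ring.
Qed.

(** On the rectangle the weights are nonnegative and, after normalization, sum to 1, so the value is
    an average of samples of [f], each bounded by the norm. *)
Lemma bernstein_le m n (f : C) p :
  a < b -> c < d -> D p -> `|bernstein m n f p| <= `|f|.
Proof.
move=> ab cd [/=]; rewrite !in_itv /= => /andP[x1 x2] /andP[y1 y2].
have K0 : 0 < (b - a) ^+ m * (d - c) ^+ n.
  by rewrite mulr_gt0 // exprn_gt0 // subr_gt0.
rewrite /bernstein normrM gtr0_norm ?invr_gt0 // ler_pdivrMl //.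
(* Writing the normalizing factor as a double sum of weights allows a termwise comparison. *)
rewrite -(binomial_weights m p.1 a b) -(binomial_weights n p.2 c d).
rewrite mulr_suml mulr_suml.
apply: le_trans (ler_norm_sum _ _ _) _; apply: ler_sum => i _.
rewrite mulr_sumr mulr_suml.
apply: le_trans (ler_norm_sum _ _ _) _; apply: ler_sum => j _.
rewrite -!mulrA normrM.
set w := 'C(m, i)%:R * _; set w' := (X in _ <= X).
have w0 : 0 <= w by rewrite /w !mulr_ge0 // exprn_ge0 // subr_ge0.
have -> : w' = `|f| * w by rewrite /w' /w; ring.
by rewrite (ger0_norm w0) ler_wpM2r // ceval_le.
Qed.

Lemma bernstein_continuous m n (f : C) : continuous (bernstein m n f).
Proof.
have cM (s t : R * R -> R) p : {for p, continuous s} ->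
    {for p, continuous t} -> {for p, continuous (fun q => s q * t q)}.
  exact: continuousM.
have csum k (F : 'I_k -> R * R -> R) : (forall i, continuous (F i)) ->
    continuous (fun p => \sum_i F i p).
  move=> cF; apply: (@continuous_big R _ +%R 0 xpredT) => // p.
  exact: add_continuous.
have cexp (h : R * R -> R) k p : {for p, continuous h} ->
    {for p, continuous (fun q => h q ^+ k)}.
  move=> ch; apply: (continuous_comp (g := fun x : R => x ^+ k)) ch _.
  exact: exprn_continuous.
have ck (k : R) (p : R * R) : {for p, continuous (fun _ : R * R => k)}.
  exact: cvg_cst.
have c1 p : {for p, continuous (fst : R * R -> R)} by exact: cvg_fst.
have c2 p : {for p, continuous (snd : R * R -> R)} by exact: cvg_snd.
have cB (s t : R * R -> R) p : {for p, continuous s} ->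
    {for p, continuous t} -> {for p, continuous (fun q => s q - t q)}.
  exact: continuousB.
move=> p; apply: (cM); first exact: ck.
apply: (csum) => i; apply: (csum) => j q.
(* Each summand is a constant times four powers of affine functions. *)
by do 4!(apply: (cM); last by apply: cexp; apply: cB); exact: ck.
Qed.

End BernsteinBounds.

(** Serves to compose with the glued inverses, which are continuous only relative to their
    segment. *)
Lemma continuous_comp_within {X Y Z : topologicalType} (A : set Y)
    (h : X -> Y) (g : Y -> Z) :
  {within A, continuous g} -> (forall x, A (h x)) -> continuous h ->
  continuous (g \o h).
Proof.
move=> /subspace_continuousP cg Ah ch x B /(cg _ (Ah x)).
rewrite /= /nbhs /= /within /= => gB.
have := ch x _ gB; rewrite /= !nbhs_simpl /=.
by apply: filterS => y; apply; exact: Ah.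
Qed.

(** * Existence, uniqueness and norm estimate for fractal functions *)

Section FractalFunctions.
Context {R : realType} {a b c d : R} (ltab : a < b) (ltcd : c < d).
Local Notation D := (rect a b c d).
Local Notation C := (contfun a b c d).
Variable Delta : net a b c d.
Local Notation N := (axis_size (net_x Delta)).
Local Notation M := (axis_size (net_y Delta)).
Local Notation patch i j := (cell (net_x Delta) i `*` cell (net_y Delta) j).

Lemma net_cover q : D q -> exists i j,
  [/\ (1 <= i <= N)%N, (1 <= j <= M)%N & patch i j q].
Proof.
move=> [/(cell_cover (net_x Delta))[i iN qi]].
by move=> /(cell_cover (net_y Delta))[j jM qj]; exists i, j.
Qed.

Lemma net_inv_rect i j q : (1 <= i <= N)%N -> (1 <= j <= M)%N ->
  patch i j q -> D (net_inv Delta i j q).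
Proof. by move=> iN jM [qi qj]; split; exact: inv_itv. Qed.

Lemma glued_net_inv : exists Q : D -> D, continuous Q /\
  forall i j (p : D), (1 <= i <= N)%N -> (1 <= j <= M)%N ->
    patch i j (\val p) -> \val (Q p) = net_inv Delta i j (\val p).
Proof.
have [U [Ui Uc]] := glued_inverse (net_x Delta) ltab.
have [V [Vj Vc]] := glued_inverse (net_y Delta) ltcd.
have UVD (p : D) : (U (\val p).1, V (\val p).2) \in D.
  rewrite inE; have [i [j [iN jM pij]]] := net_cover (set_valP p).
  have [pi pj] := pij.
  by rewrite (Ui i) // (Vj j) //; exact: (net_inv_rect iN jM pij).
exists (fun p => SigSub (UVD p)); split; last first.
  by move=> i j p iN jM [pi pj]; rewrite /net_inv /= (Ui i) // (Vj j).
have cval : continuous (\val : D -> R * R) by exact: initial_continuous.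
(* The rectangle carries the initial topology of [\val], so continuity is checked in the plane,
   coordinate by coordinate. *)
apply: continuous_comp_initial => p.
apply: (@cvg_pair _ _ _ (nbhs p) (nbhs (U (\val p).1)) (nbhs (V (\val p).2))).
  apply: (continuous_comp_within Uc) p => [p|p]; first exact: (set_valP p).1.
  by apply: continuous_comp; [exact: cval|exact: cvg_fst].
apply: (continuous_comp_within Vc) p => [p|p]; first exact: (set_valP p).2.
by apply: continuous_comp; [exact: cval|exact: cvg_snd].
Qed.

Lemma fractal_eqB (alpha : C) m n (f1 f2 g1 g2 : C) :
  fractal_eq Delta alpha m n f1 g1 -> fractal_eq Delta alpha m n f2 g2 ->
  fractal_eq Delta alpha m n (f1 - f2) (g1 - g2).
Proof.
move=> e1 e2 i j p iN jM pij; rewrite !cevalB bernsteinB.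
by rewrite (e1 i j) // (e2 i j) //; ring.
Qed.

Lemma fractal_eqZ (alpha : C) m n (l : R) (f g : C) :
  fractal_eq Delta alpha m n f g ->
  fractal_eq Delta alpha m n (l *: f) (l *: g).
Proof.
move=> e i j p iN jM pij; rewrite !cevalZ bernsteinZ (e i j) //.
by ring.
Qed.

Lemma fractal_eq_norm (alpha : C) m n (f g : C) :
  fractal_eq Delta alpha m n f g ->
  (1 - `|alpha|) * `|g| <= (1 + `|alpha|) * `|f|.
Proof.
(* One summand for each term of the functional equation, the last by [bernstein_le]. *)
move=> e; suff : `|g| <= `|f| + `|alpha| * `|g| + `|alpha| * `|f| by lra.
apply: contfun_norm_le; first by rewrite !addr_ge0 // mulr_ge0.
move=> q /net_cover[i [j [iN jM qij]]]; rewrite (e i j) //.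
apply: le_trans (ler_normB _ _) _; apply: lerD.
  apply: le_trans (ler_normD _ _) _; apply: lerD; first exact: ceval_le.
  by rewrite normrM ler_pM // ceval_le.
rewrite normrM ler_pM // ?ceval_le //; apply: bernstein_le => //.
exact: net_inv_rect.
Qed.

(** The difference of two solutions solves the equation for [f = 0], and the norm estimate forces it
    to vanish. *)
Lemma fractal_eq_unique (alpha : C) m n (f g1 g2 : C) : `|alpha| < 1 ->
  fractal_eq Delta alpha m n f g1 -> fractal_eq Delta alpha m n f g2 ->
  g1 = g2.
Proof.
move=> alpha1 e1 e2; have := fractal_eq_norm (fractal_eqB e1 e2).
rewrite subrr normr0 mulr0 pmulr_rle0 ?subr_gt0 // normr_le0 subr_eq0.
by move/eqP.
Qed.

Lemma fractal_eq_exists (alpha : C) m n (f : C) : `|alpha| < 1 ->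
  exists g, fractal_eq Delta alpha m n f g.
Proof.
move=> alpha1; have [Q [cQ Qij]] := glued_net_inv.
have cb : continuous (fun p : D => bernstein m n f (\val p)).
  move=> p; apply: (@continuous_comp _ _ _ (\val : D -> R * R)).
    exact: initial_continuous.
  exact: bernstein_continuous.
(* Using the global continuous [Q] instead of the pieces [Q_ij] makes the image of [g]
   continuous. *)
have cT (g : C) : (fun p => f p +
    alpha p * (g (Q p) - bernstein m n f (\val (Q p)))) \in cont_rect.
  rewrite inE => p.
  have cgQ := continuous_comp (cQ p) (@contfun_cont _ _ _ _ _ g (Q p)).
  have cbQ := continuous_comp (cQ p) (cb (Q p)).
  apply: continuousD; first exact: contfun_cont.
  apply: (@continuousM _ _ alpha); first exact: contfun_cont.
  exact: continuousB.
pose T (g : C) : C := ContFun (cT g).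
have : is_contraction (totalfun T).
  exists `|alpha|%:nng; split => //= -[g h] _ /=.
  apply: sup_norm_le; first by rewrite mulr_ge0.
  (* The terms in [f] and its Bernstein polynomial cancel. *)
  move=> p; have -> : (T g - T h) p = alpha p * (g - h) (Q p).
    by rewrite !contfunDE !contfunNE /=; ring.
  by rewrite normrM ler_pM //; exact: sup_norm_ge.
move/banach_fixed_point => [|| g _ gT]; [exact: closedT|by exists 0|].
exists g => i j q iN jM qij.
have Dq : q \in D.
  have [qi qj] := qij; rewrite inE.
  by split; [exact: cell_itv qi|exact: cell_itv qj].
rewrite -[q]/(\val (SigSub Dq : D)) -(Qij i j) //.
by rewrite !cevalE [in LHS]gT /=; ring.
Qed.

(** Uniqueness being automatic, only the functional equation remains to be handled. *)
Lemma fractal_functionP (alpha : C) m n (f g : C) : `|alpha| < 1 ->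
  is_fractal_function Delta alpha m n f g <-> fractal_eq Delta alpha m n f g.
Proof.
move=> alpha1; split=> [[]//|e]; split=> // h.
exact: fractal_eq_unique alpha1 e.
Qed.

End FractalFunctions.

(** * Process and Lipschitz properties of the multi-valued mapping *)

Theorem theorem3p4 (R : realType) (a b c d : R) (ltab : a < b) (ltcd : c < d)
  (Delta : net a b c d) (alpha : contfun a b c d) (alpha_lt1 : `|alpha| < 1) :
  is_lipschitz_multi (fractal_multi Delta alpha) /\
  is_process (fractal_multi Delta alpha).
Proof.
have fracP m n f g : is_fractal_function Delta alpha m n f g <->
    fractal_eq Delta alpha m n f g by exact: fractal_functionP.
split; last first.
  have sub (f : contfun a b c d) (l : R) g :
      fractal_multi Delta alpha f g ->
      fractal_multi Delta alpha (l *: f) (l *: g).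
    move=> [m [n [m0 n0 /fracP e]]]; exists m, n; split => //.
    by apply/fracP; exact: fractal_eqZ.
  split.
    move=> f l l0; apply/seteqP; split=> [_ [g fg <-]|g fg]; first exact: sub.
    (* The reverse inclusion is [sub] applied with the factor [l^-1]. *)
    exists (l^-1 *: g); last by rewrite scalerA divff ?gt_eqF // scale1r.
    have := sub (l *: f) l^-1 g fg.
    by rewrite scalerA mulVf ?gt_eqF // scale1r.
  exists 1%N, 1%N; split => //; apply/fracP => i j p _ _ _.
  by rewrite !ceval0 bernstein0 !mulr0 addr0 subr0.
pose L := (1 + `|alpha|) / (1 - `|alpha|).
have L0 : 0 < L by rewrite divr_gt0 ?subr_gt0 // ltr_pwDl.
exists L => // f1 f2 _ _ g1 [m [n [m0 n0 /fracP e1]]].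
(* [g2] is taken with the same indices [m], [n] as [g1], so that the two equations can be
   subtracted. *)
have [g2 e2] := fractal_eq_exists ltab ltcd Delta m n f2 alpha_lt1.
have g12 : `|g1 - g2| <= L * `|f1 - f2|.
  have := fractal_eq_norm ltab ltcd (fractal_eqB e1 e2).
  by rewrite /L mulrAC ler_pdivlMr ?subr_gt0 // mulrC.
exists g2; first by exists m, n; split => //; apply/fracP.
(* The unit-ball vector is [g1 - g2] divided by this quantity; if it is zero, then [g1 = g2] and the
   vector 0 serves. *)
have [f0|f0] := eqVneq (L * `|f1 - f2|) 0.
  exists 0; first by rewrite /= normr0.
  rewrite scaler0 addr0; apply/esym/eqP; rewrite -subr_eq0 -normr_le0.
  by rewrite -f0.
have f0_gt0 : 0 < L * `|f1 - f2|.
  by rewrite lt_neqAle eq_sym f0 mulr_ge0 // ltW.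
exists ((L * `|f1 - f2|)^-1 *: (g1 - g2)).
  by rewrite /= normrZ gtr0_norm ?invr_gt0 // ler_pdivrMl // mulr1.
by rewrite scalerA divff // scale1r addrC subrK.
Qed.
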